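(* Let $G$ be a connected graph. If there is a vertex $u$ of $G$ with $\chi(N_2(u))\ge 3$, then $\chi_c(G)\ge 3$.
   Context: Graphs are finite, simple and undirected. For positive integers $k\ge 2d$, a $(k,d)$-coloring of $G$ is a map $f:V(G)\to\{0,1,\dots,k-1\}$ such that $d\le |f(x)-f(y)|\le k-d$ for every edge $xy$; $G$ is $(k,d)$-colorable if it has one. The circular chromatic number is $\chi_c(G)=\inf\{k/d: G\text{ is }(k,d)\text{-colorable}\}$. $N_2(u)=\{v\in V(G): d_G(u,v)=2\}$, where $d_G$ is the graph distance; $\chi(S)$ for $S\subseteq V(G)$ denotes the (ordinary) chromatic number of the subgraph of $G$ induced by $S$. *)

(* Defs.v *)
From HB Require Import structures.
From mathcomp Require Import all_boot all_order all_algebra.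
From mathcomp Require Import boolp classical_sets reals.

Set Implicit Arguments.
Unset Strict Implicit.
Unset Printing Implicit Defensive.

Import Order.TTheory GRing.Theory Num.Theory.

Local Open Scope ring_scope.
Local Open Scope classical_set_scope.

Record sgraph := SGraph {
  vertex :> finType;
  edge : rel vertex;
  edge_sym : symmetric edge;
  edge_irrefl : irreflexive edge }.

Definition connected_graph (G : sgraph) : Prop :=
  forall x y : G, connect (@edge G) x y.

Definition has_walk (G : sgraph) (x y : G) (n : nat) : bool :=
  [exists p : n.-tuple G, path (@edge G) x p && (last x p == y)].

(* The distance is given as a relation, so that no default value is needed
   for vertices in different components. *)
Definition dist_is (G : sgraph) (x y : G) (n : nat) : bool :=
  has_walk x y n && [forall m : 'I_n, ~~ has_walk x y m].

Definition N2 (G : sgraph) (u : G) : {set G} := [set v | dist_is u v 2]%SET.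

Section Induced.
Variables (G : sgraph) (S : {set G}).

Definition induced_edge : rel {x : G | x \in S} :=
  fun x y => edge (val x) (val y).

Lemma induced_edge_sym : symmetric induced_edge.
Proof. by move=> x y; rewrite /induced_edge edge_sym. Qed.

Lemma induced_edge_irrefl : irreflexive induced_edge.
Proof. by move=> x; rewrite /induced_edge edge_irrefl. Qed.

Definition induced : sgraph := SGraph induced_edge_sym induced_edge_irrefl.

End Induced.

Definition colorable (G : sgraph) (k : nat) : bool :=
  [exists f : {ffun G -> 'I_k},
    [forall x : G, forall y : G, edge x y ==> (f x != f y)]].

Lemma ex_colorable (G : sgraph) : exists k, colorable G k.
Proof.
exists #|G|; apply/existsP; exists [ffun x => enum_rank x].
apply/forallP => x; apply/forallP => y; apply/implyP => xy.
rewrite !ffunE (inj_eq enum_rank_inj).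
by apply: contraTneq xy => ->; rewrite edge_irrefl.
Qed.

Definition chi (G : sgraph) : nat := ex_minn (ex_colorable G).

(* `|a - b|%N on naturals is the absolute value of the integer difference;
   k - d is truncated subtraction, exact whenever 2 * d <= k. *)
Definition kd_colorable (G : sgraph) (k d : nat) : Prop :=
  exists f : G -> 'I_k, forall x y : G, edge x y ->
    (d <= `|(f x : nat) - (f y : nat)| <= k - d)%N.

Definition chi_c (R : realType) (G : sgraph) : R :=
  inf [set r : R | exists k d : nat,
    [/\ (0 < d)%N, (2 * d <= k)%N, kd_colorable G k d & r = k%:R / d%:R]].

(* Main.v *)
Require Import Defs.
From mathcomp Require Import all_boot all_order all_algebra.
From mathcomp Require Import boolp classical_sets reals.
From mathcomp Require Import zify.

(** Place the colors [0, ..., k-1] of a [(k, d)]-coloring [f] on a circle of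
    length [k]: adjacent vertices get colors at circular distance at least [d].
    Measure colors by their offset from [f u]. A neighbor of [u] has offset in
    [[d, k-d]], so a vertex two steps away from [u] has, modulo [k], offset in
    [[2d, 2k-2d]], an arc centred at the color of [u] itself. That color cuts
    the arc into two arcs of length [k-2d]. If [k < 3d], each half is shorter
    than [d], hence spans an independent set, and the two halves give a proper
    2-coloring of the second neighborhood of [u]. So a second neighborhood of
    chromatic number at least 3 forces [3d <= k] for every pair [(k, d)] over
    which the infimum [chi_c] is taken; what remains is that this set of pairs
    is nonempty, since in a real type the infimum of the empty set is 0. *)

Set Implicit Arguments.
Unset Strict Implicit.
Unset Printing Implicit Defensive.

Import Order.TTheory GRing.Theory Num.Theory.

Local Open Scope ring_scope.

Definition circ_offset (k a b : nat) : nat :=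
  if (a <= b)%N then (b - a)%N else (b + k - a)%N.

(** This is where the hypothesis [k < 3d] enters: [c] and [c'] are each two
    steps away from [a], so their offsets lie in [[0, k-2d]] or in
    [[2d, k-1]]. Adjacent colors cannot share one of these arcs, and comparing
    the offset with [d] tells the arcs apart because [k-2d < d]. *)
Lemma circ_offset_adjacent_neq (k d a b b' c c' : nat) :
  (k < 3 * d)%N -> (a < k)%N -> (c < k)%N -> (c' < k)%N ->
  (d <= `|a - b| <= k - d)%N -> (d <= `|b - c| <= k - d)%N ->
  (d <= `|a - b'| <= k - d)%N -> (d <= `|b' - c'| <= k - d)%N ->
  (d <= `|c - c'| <= k - d)%N ->
  (circ_offset k a c < d)%N != (circ_offset k a c' < d)%N.
Proof. by rewrite /circ_offset; case: ifP; case: ifP; lia. Qed.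

Lemma N2_common_neighbor (G : sgraph) (u v : G) :
  v \in N2 u -> exists2 w, edge u w & edge w v.
Proof.
rewrite inE => /andP[/existsP[p /andP[+ /eqP <-]] _].
by case/tupleP: p => w p; case/tupleP: p => v' p; rewrite tuple0 /=;
   case/and3P => uw wv _; exists w.
Qed.

Lemma N2_2colorable (G : sgraph) (u : G) (k d : nat) :
  (k < 3 * d)%N -> kd_colorable G k d -> colorable (induced (N2 u)) 2.
Proof.
move=> k3d [f fP]; apply/existsP.
exists [ffun x => if (circ_offset k (f u) (f (val x)) < d)%N
                  then ord0 else ord_max].
apply/forallP => x; apply/forallP => y; apply/implyP => xy.
have [w uw wx] := N2_common_neighbor (valP x).
have [w' uw' wy] := N2_common_neighbor (valP y).
have := circ_offset_adjacent_neq k3d (ltn_ord (f u)) (ltn_ord _) (ltn_ord _)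
  (fP _ _ uw) (fP _ _ wx) (fP _ _ uw') (fP _ _ wy) (fP _ _ xy).
by rewrite !ffunE; do 2!case: ifP.
Qed.

Lemma chi_le (G : sgraph) (k : nat) : colorable G k -> (chi G <= k)%N.
Proof. by rewrite /chi; case: ex_minnP => m _; apply. Qed.

(** With [d = 1] the circular condition only asks adjacent colors to differ,
    because colors below [k] differ by at most [k - 1]. The extra color ensures
    [2 * 1 <= k] when [G] is a single vertex. *)
Lemma kd_colorable_card (G : sgraph) : kd_colorable G #|G|.+1 1.
Proof.
exists (fun x => widen_ord (leqnSn _) (enum_rank x)) => x y xy /=.
have rank_neq : enum_rank x != enum_rank y :> nat.
  by apply: contraTneq xy => /val_inj/enum_rank_inj ->; rewrite edge_irrefl.
move: (ltn_ord (enum_rank x)) (ltn_ord (enum_rank y)) rank_neq.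
(* The cardinal occurs in two convertible but syntactically distinct forms,
   which this generalization identifies. *)
by move: #|_| (nat_of_ord _) (nat_of_ord _) => n a b; lia.
Qed.

Theorem corollary11 (R : realType) (G : sgraph) (hG : connected_graph G) :
  (exists u : G, (3 <= chi (induced (N2 u)))%N) -> 3 <= chi_c R G.
Proof.
move=> [u chi3]; apply: lb_le_inf.
  have G_gt0 : (0 < #|G|)%N by apply/card_gt0P; exists u.
  by exists (#|G|.+1%:R / 1%:R), #|G|.+1, 1%N; split => //;
    exact: kd_colorable_card.
move=> _ [k [d [d_gt0 _ fkd ->]]].
rewrite ler_pdivlMr ?ltr0n // -natrM ler_nat leqNgt.
by apply: contraTN chi3 => k3d; rewrite -ltnNge ltnS; apply/chi_le/N2_2colorable/fkd.
Qed.
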